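(* For a ring $R$, the following are equivalent. (1) $R$ is semiperfect. (2) Every finitely generated right $R$-module has a max-projective cover. (3) Every cyclic right $R$-module has a max-projective cover. (4) Every simple right $R$-module has a max-projective cover.
   Context: Rings are associative with identity; modules are unital right modules. A right $R$-module $M$ is max-projective if for every maximal right ideal $I$ of $R$, every homomorphism $M\to R/I$ factors through the canonical projection $R\to R/I$. A submodule $K$ of $P$ is small (superfluous) if $K+L\neq P$ for every proper submodule $L$ of $P$. A max-projective cover of a right $R$-module $M$ is an epimorphism $f:P\to M$ with $P$ max-projective and $\ker f$ small in $P$. *)

(* Defs.v *)
From HB Require Import structures.
From mathcomp Require Import all_boot all_algebra.
From mathcomp Require Import boolp.

Set Implicit Arguments.
Unset Strict Implicit.
Unset Printing Implicit Defensive.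

Import GRing.Theory.

Local Open Scope ring_scope.
Local Open Scope quotient_scope.

(* Submodules are the boolean predicates of type submodClosed V.  Classically
   this is no restriction: a Prop-valued P is represented by x |-> `[< P x >]. *)

Section Modules.
Variable A : pzRingType.
Implicit Types M N : lmodType A.

Definition proper_sub M (N : {pred M}) : Prop := exists x, x \notin N.

Definition full_sub M (N : {pred M}) : Prop := forall x, x \in N.

Definition zero_sub M (N : {pred M}) : Prop := forall x, x \in N -> x = 0.

(* K + L = M *)
Definition sum_is_full M (K L : {pred M}) : Prop :=
  forall x, exists y z, [/\ y \in K, z \in L & x = y + z].

Definition maximal_sub M (N : submodClosed M) : Prop :=
  proper_sub N /\
  forall L : submodClosed M, {subset N <= L} -> L =i N \/ full_sub L.

Definition small_sub M (K : submodClosed M) : Prop :=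
  forall L : submodClosed M, proper_sub L -> ~ sum_is_full K L.

Definition fin_generated M : Prop :=
  exists (n : nat) (v : 'I_n -> M),
    forall x, exists c : 'I_n -> A, x = \sum_(i < n) c i *: v i.

Definition cyclic_module M : Prop :=
  exists v : M, forall x, exists a : A, x = a *: v.

Definition simple_module M : Prop :=
  (exists x : M, x != 0) /\
  forall N : submodClosed M, zero_sub N \/ full_sub N.

Definition semisimple_module M : Prop :=
  forall N : submodClosed M, exists N' : submodClosed M,
    sum_is_full N N' /\ (forall x, x \in N -> x \in N' -> x = 0).

Definition epimorphism M N (f : M -> N) : Prop := forall y, exists x, f x = y.

Section Kernel.
Variables (M N : lmodType A) (f : {linear M -> N}).

Definition kernel : {pred M} := fun x => f x == 0.

Fact kernel_closed : subsemimod_closed kernel.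
Proof.
split; first split.
- by rewrite unfold_in linear0.
- by move=> x y; rewrite !unfold_in linearD => /eqP -> /eqP ->; rewrite addr0.
- by move=> a x; rewrite !unfold_in linearZ_LR => /eqP ->; rewrite scaler0.
Qed.

HB.instance Definition _ := GRing.isSubmodClosed.Build A M kernel kernel_closed.

End Kernel.

Section Quotient.
Variables (M : lmodType A) (N : submodClosed M).

(* submodClosed does not record closure under opposites, which
   Quotient.quot requires. *)
Definition zmod_sub : {pred M} := N.

Fact zmod_sub_closed : zmod_closed zmod_sub.
Proof. exact/GRing.submod_closedB/submodClosedP. Qed.

HB.instance Definition _ := GRing.isZmodClosed.Build M zmod_sub zmod_sub_closed.

Definition quotmod : Type := Quotient.quot zmod_sub.

HB.instance Definition _ := ZmodQuotient.on quotmod.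

Fact quotmodP (x y : M) : x = y %[mod quotmod] <-> x - y \in N.
Proof.
have -> : (x - y \in N) = (x == y %[mod quotmod]) := Quotient.idealrBE zmod_sub x y.
exact: rwP eqP.
Qed.

Definition quotmod_scale (a : A) (u : quotmod) : quotmod :=
  \pi_quotmod (a *: repr u).

Fact pi_quotmod_scale a x :
  \pi_quotmod (a *: x) = quotmod_scale a (\pi_quotmod x).
Proof.
by apply/quotmodP; rewrite -scalerBr rpredZ //; apply/quotmodP; rewrite reprK.
Qed.

Fact quotmod_scaleA a b u :
  quotmod_scale a (quotmod_scale b u) = quotmod_scale (a * b) u.
Proof. by rewrite -[u]reprK -(pi_quotmod_scale b) -!pi_quotmod_scale scalerA. Qed.

Fact quotmod_scale1 : left_id 1 quotmod_scale.
Proof. by move=> u; rewrite -[u]reprK -pi_quotmod_scale scale1r. Qed.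

Fact quotmod_scaleDr : right_distributive quotmod_scale +%R.
Proof.
move=> a u v; rewrite -[u]reprK -[v]reprK -raddfD -!pi_quotmod_scale.
by rewrite scalerDr raddfD.
Qed.

Fact quotmod_scaleDl u :
  {morph (fun a => quotmod_scale a u) : a b / a + b >-> a + b}.
Proof.
by move=> a b; rewrite -[u]reprK -!pi_quotmod_scale scalerDl raddfD.
Qed.

HB.instance Definition _ := GRing.Zmodule_isLmodule.Build A quotmod
  quotmod_scaleA quotmod_scale1 quotmod_scaleDr quotmod_scaleDl.

HB.instance Definition _ :=
  GRing.isScalable.Build A M quotmod *:%R \pi_quotmod pi_quotmod_scale.

End Quotient.
End Modules.

(* Right R-modules are left modules over the converse ring R^c, so r *: m
   stands for m r, and the right module R_R is R^c^o. *)
Notation rmodType R := (lmodType R^c).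
Notation right_ideal R := (submodClosed R^c^o).

Definition max_projective (R : pzRingType) (M : rmodType R) : Prop :=
  forall I : right_ideal R, maximal_sub I ->
  forall h : {linear M -> quotmod I},
  exists g : {linear M -> R^c^o}, forall x, h x = \pi_(quotmod I) (g x).

Definition max_projective_cover (R : pzRingType) (P M : rmodType R)
    (f : {linear P -> M}) : Prop :=
  [/\ epimorphism f, max_projective P & small_sub (kernel f)].

Definition has_max_projective_cover (R : pzRingType) (M : rmodType R) : Prop :=
  exists (P : rmodType R) (f : {linear P -> M}), max_projective_cover f.

Section Jacobson.
Variable R : pzRingType.

Definition jacobson : {pred R^c^o} :=
  fun x => `[< forall I : right_ideal R, maximal_sub I -> x \in I >].

Fact jacobsonP (x : R^c^o) :
  x \in jacobson <-> forall I : right_ideal R, maximal_sub I -> x \in I.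
Proof. by split=> /asboolP. Qed.

Fact jacobson_closed : subsemimod_closed jacobson.
Proof.
split; first split.
- by apply/jacobsonP => I _; rewrite rpred0.
- move=> x y /jacobsonP xJ /jacobsonP yJ; apply/jacobsonP => I mI.
  by rewrite rpredD ?xJ ?yJ.
- move=> a x /jacobsonP xJ; apply/jacobsonP => I mI.
  by rewrite rpredZ ?xJ.
Qed.

HB.instance Definition _ :=
  GRing.isSubmodClosed.Build R^c R^c^o jacobson jacobson_closed.

Fact jacobson_mull (a x : R) : x \in jacobson -> (a * x : R) \in jacobson.
Proof.
move=> /jacobsonP xJ; apply/jacobsonP => I mI.
have [_ maxI] := mI.
have [aI|aNI] := boolP ((a : R^c^o) \in I); first exact: (@rpredZ _ _ I x a).
pose Ia : {pred R^c^o} := fun y => (a * y : R) \in I.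
have IaE (y : R) : (y \in Ia) = ((a * y : R) \in I) by [].
have Ia_closed : subsemimod_closed Ia.
  split; first split.
  - by rewrite IaE mulr0; exact: rpred0.
  - by move=> y z; rewrite !IaE mulrDr => yI zI; exact: rpredD yI zI.
  - move=> b y; rewrite !IaE => yI.
    by rewrite mulrA; exact: (@rpredZ _ _ I b _ yI).
pose IaM := GRing.isSubmodClosed.Build _ _ Ia Ia_closed.
pose Ia' : right_ideal R := HB.pack Ia IaM.
suff mIa : maximal_sub Ia' by exact: xJ Ia' mIa.
split=> [|L IaL].
  by exists (1 : R); rewrite [_ \in _]IaE mulr1.
have [[y yL yNIa]|LIa] := pselect (exists2 y, y \in L & y \notin Ia'); last first.
  left=> y; apply/idP/idP => [yL|]; last exact: IaL.
  by apply/negPn/negP => yNIa; apply: LIa; exists y.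
right=> z.
pose K : {pred R^c^o} := fun u => `[< exists r : R, (u - a * y * r : R) \in I >].
have K_closed : subsemimod_closed K.
  split; first split.
  - by apply/asboolP; exists 0; rewrite mulr0 subr0; exact: rpred0.
  - move=> u v /asboolP[r ur] /asboolP[s vs]; apply/asboolP; exists (r + s).
    by rewrite mulrDr opprD addrACA; exact: rpredD.
  - move=> b u /asboolP[r ur]; apply/asboolP; exists (r * b).
    have -> : (b *: (u : R^c^o)) - a * y * (r * b) = (u - a * y * r : R) * b :> R.
      by rewrite mulrBl !mulrA.
    exact: (@rpredZ _ _ I b _ ur).
pose KM := GRing.isSubmodClosed.Build _ _ K K_closed.
pose K' : right_ideal R := HB.pack K KM.
have [KI|Kfull] : K' =i I \/ full_sub K'.
- by apply: maxI => u uI; apply/asboolP; exists 0; rewrite mulr0 subr0.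
- move: yNIa; rewrite [y \in _]IaE -KI => /negP[].
  by apply/asboolP; exists 1; rewrite mulr1 subrr; exact: rpred0.
have /asboolP[r ar] := Kfull (a : R).
have oL : (1 - (y : R) * r) \in L.
  by apply: IaL; rewrite [_ \in _]IaE mulrBr mulr1 mulrA.
have L1 : (1 : R) \in L.
  rewrite -[1 : R](subrK ((y : R) * r)); apply: rpredD oL _.
  exact: (@rpredZ _ _ L r _ yL).
suff: ((1 : R) * (z : R)) \in L by rewrite mul1r.
exact: (@rpredZ _ _ L z _ L1).
Qed.

Fact jacobson_mulr (a x : R) : x \in jacobson -> (x * a : R) \in jacobson.
Proof. exact: (@rpredZ _ _ jacobson a x). Qed.

Definition quot_jacobson : Type := quotmod jacobson.

HB.instance Definition _ := ZmodQuotient.on quot_jacobson.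

Definition quot_jacobson_mul (u v : quot_jacobson) : quot_jacobson :=
  let x : R := repr u in let y : R := repr v in \pi_quot_jacobson (x * y).

Fact pi_quot_jacobson_mul (x y : R) :
  \pi_quot_jacobson (x * y : R) =
  quot_jacobson_mul (\pi_quot_jacobson x) (\pi_quot_jacobson y).
Proof.
pose x' : R := repr (\pi_quot_jacobson x).
pose y' : R := repr (\pi_quot_jacobson y).
have xx' : (x - x' : R) \in jacobson by apply/quotmodP; rewrite reprK.
have yy' : (y - y' : R) \in jacobson by apply/quotmodP; rewrite reprK.
apply/quotmodP; suff: (x * y - x' * y' : R) \in jacobson by [].
have -> : x * y - x' * y' = (x - x') * y + x' * (y - y').
  by rewrite mulrBl mulrBr addrA subrK.
by apply: rpredD; [exact: jacobson_mulr | exact: jacobson_mull].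
Qed.

Fact quot_jacobsonW (P : quot_jacobson -> Prop) :
  (forall x : R, P (\pi_quot_jacobson x)) -> forall u, P u.
Proof. by move=> Ppi u; rewrite -[u]reprK. Qed.

Fact pi_quot_jacobsonD (x y : R) :
  \pi_quot_jacobson (x + y) = \pi_quot_jacobson x + \pi_quot_jacobson y.
Proof. exact: (raddfD \pi_quot_jacobson). Qed.

Let one : quot_jacobson := \pi_quot_jacobson (1 : R).

Fact quot_jacobson_mulA : associative quot_jacobson_mul.
Proof.
elim/quot_jacobsonW=> x; elim/quot_jacobsonW=> y; elim/quot_jacobsonW=> z.
rewrite -(pi_quot_jacobson_mul y z) -(pi_quot_jacobson_mul x y).
by rewrite -(pi_quot_jacobson_mul x) -(pi_quot_jacobson_mul _ z) mulrA.
Qed.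

Fact quot_jacobson_mul1 : left_id one quot_jacobson_mul.
Proof.
by elim/quot_jacobsonW=> x; rewrite -(pi_quot_jacobson_mul 1 x) mul1r.
Qed.

Fact quot_jacobson_mulr1 : right_id one quot_jacobson_mul.
Proof.
by elim/quot_jacobsonW=> x; rewrite -(pi_quot_jacobson_mul x 1) mulr1.
Qed.

Fact quot_jacobson_mulDl : left_distributive quot_jacobson_mul +%R.
Proof.
elim/quot_jacobsonW=> x; elim/quot_jacobsonW=> y; elim/quot_jacobsonW=> z.
rewrite -(pi_quot_jacobsonD x y) -(pi_quot_jacobson_mul (x + y) z).
rewrite -(pi_quot_jacobson_mul x z) -(pi_quot_jacobson_mul y z).
by rewrite -pi_quot_jacobsonD mulrDl.
Qed.

Fact quot_jacobson_mulDr : right_distributive quot_jacobson_mul +%R.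
Proof.
elim/quot_jacobsonW=> x; elim/quot_jacobsonW=> y; elim/quot_jacobsonW=> z.
rewrite -(pi_quot_jacobsonD y z) -(pi_quot_jacobson_mul x (y + z)).
rewrite -(pi_quot_jacobson_mul x y) -(pi_quot_jacobson_mul x z).
by rewrite -pi_quot_jacobsonD mulrDr.
Qed.

HB.instance Definition _ := GRing.Zmodule_isPzRing.Build quot_jacobson
  quot_jacobson_mulA quot_jacobson_mul1 quot_jacobson_mulr1
  quot_jacobson_mulDl quot_jacobson_mulDr.

End Jacobson.

Definition semisimple_ring (R : pzRingType) : Prop :=
  semisimple_module (R^c^o : rmodType R).

Definition idempotents_lift (R : pzRingType) : Prop :=
  forall u : quot_jacobson R, u * u = u ->
  exists e : R, e * e = e /\ \pi_(quot_jacobson R) e = u.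

Definition semiperfect (R : pzRingType) : Prop :=
  semisimple_ring (quot_jacobson R) /\ idempotents_lift R.

(* Main.v *)
From HB Require Import structures.
From mathcomp Require Import all_boot all_algebra.
From mathcomp Require Import boolp classical_sets.
Require Import Defs.

Set Implicit Arguments.
Unset Strict Implicit.
Unset Printing Implicit Defensive.

Import GRing.Theory.

Local Open Scope ring_scope.
Local Open Scope quotient_scope.

(** Right R-modules are treated throughout as left modules over A = R^c, in which
    products are reversed; J is the Jacobson radical, and R/J is viewed both as a
    ring and as an R-module. This overview uses right-module notation.

    A module spanned by finitely many vectors, each generating a simple
    submodule, is covered by a class C of modules as soon as simple modules are
    and C is stable under finite products: vectors are added one at a time,
    skipping those already reached, so that each new line meets the previous
    span trivially and the kernels stay small (cover_complement). The same
    construction produces a complement of any given submodule, and hence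
    semisimplicity. It is used for C = projective and for C = max_projective.

    If R is semiperfect, a complement of I/J in R/J, for a maximal right ideal I,
    yields an idempotent of R/J, which lifts to an idempotent e of R outside I
    with eI inside J. Then eR covers R/I, so every simple module has a projective
    cover. A finitely generated module M modulo its radical is killed by J, hence
    is spanned by simple vectors and has a projective cover. That cover lifts to
    M, and the lift is onto because the radical of M is small, a consequence of
    Krull's theorem.

    Conversely, let every simple module have a max-projective cover. A cover
    P -> R/I lifts to P -> R, and an element of P above 1 is sent to some c
    outside I with cI inside J, because the image of a small submodule lies in J
    (max_projective_cover_coatom). The classes of these c modulo J generate simple
    submodules, which span R/J (spans_simple_quotient), so R/J is semisimple.

    The cover of one simple module provides no evident idempotent of R, so
    idempotents are lifted using all of R/J at once. For an idempotent u of R/J,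
    covers P1 and P2 of the images of u and 1 - u give a cover P = P1 x P2 of
    R/J, and R -> R/J factors through a surjection R -> P that sends a to p0 a.
    Since R/J is spanned by finitely many simple vectors, P -> R/J lifts to
    g : P -> R (max_projective_lift), and g p0 is 1 modulo J, hence left
    invertible; therefore p0 a = 0 forces a = 0. So R is isomorphic to P1 x P2,
    and the projection onto P1 corresponds to an idempotent of R above u. *)

(** * Submodules and linear maps given by propositions and functions *)

Section Submodules.
Variable A : pzRingType.
Implicit Types M N P : lmodType A.

Lemma submod_of M (S : M -> Prop) :
    S 0 -> (forall x y, S x -> S y -> S (x + y)) ->
    (forall a x, S x -> S (a *: x)) ->
  exists L : submodClosed M, forall x, x \in L <-> S x.
Proof.
move=> S0 SD SZ; pose p : {pred M} := fun x => `[< S x >].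
have p_closed : subsemimod_closed p.
  split; first split; first exact/asboolP.
  - by move=> x y /asboolP Sx /asboolP Sy; apply/asboolP/SD.
  - by move=> a x /asboolP Sx; apply/asboolP/SZ.
pose mixin := GRing.isSubmodClosed.Build _ _ p p_closed.
pose L : submodClosed M := HB.pack p mixin.
by exists L => x; split=> /asboolP.
Qed.

Lemma linear_of M N (f : M -> N) :
  linear f -> exists g : {linear M -> N}, g =1 f.
Proof.
move=> f_lin; pose mixin := GRing.isLinear.Build _ _ _ _ f f_lin.
by pose g : {linear M -> N} := HB.pack f mixin; exists g.
Qed.

Definition orbit_map M (v : M) (a : A^o) : M := (a : A) *: v.

Fact orbit_map_linear M (v : M) : linear (orbit_map v).
Proof. by move=> a b c; rewrite /orbit_map scalerDl scalerA. Qed.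

HB.instance Definition _ M (v : M) :=
  GRing.isLinear.Build A A^o M *:%R (orbit_map v) (orbit_map_linear v).

Lemma orbit_map1 M (v : M) : orbit_map v (1 : A^o) = v.
Proof. exact: scale1r. Qed.

Lemma subB M (L : submodClosed M) x y : x \in L -> y \in L -> x - y \in L.
Proof. by move=> xL yL; rewrite rpredD // -scaleN1r rpredZ. Qed.

Lemma subBK M (L : submodClosed M) x y : x - y \in L -> y \in L -> x \in L.
Proof. by move=> xyL yL; rewrite -(subrK y x) rpredD. Qed.

Lemma linear_prod M N P (f : {linear (M * N)%type -> P}) :
  exists (g : {linear M -> P}) (h : {linear N -> P}),
    forall x, f x = g x.1 + h x.2.
Proof.
have [|g gE] := @linear_of M P (fun x => f (x, 0)).
  by move=> a x y; rewrite -linearZ_LR -linearD; congr (f _); congr pair;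
    rewrite /= scaler0 addr0.
have [|h hE] := @linear_of N P (fun y => f (0, y)).
  by move=> a x y; rewrite -linearZ_LR -linearD; congr (f _); congr pair;
    rewrite /= scaler0 addr0.
exists g, h => -[x y]; rewrite gE hE -linearD; congr (f _); congr pair.
  by rewrite /= addr0.
by rewrite /= add0r.
Qed.

Lemma preim_sub M N (f : {linear M -> N}) (L : submodClosed N) :
  exists K : submodClosed M, forall x, (x \in K) = (f x \in L).
Proof.
have [||a x|K KP] := @submod_of M (fun x => f x \in L).
- by rewrite linear0 rpred0.
- by move=> x y xL yL; rewrite /= linearD rpredD.
- by move=> xL; rewrite linearZ_LR rpredZ.
by exists K => x; apply/idP/idP => /KP.
Qed.

Lemma sub_add_image M N (f : {linear M -> N}) (K : submodClosed M)
    (L : submodClosed N) :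
  exists S : submodClosed N,
    forall x, x \in S <-> exists2 k, k \in K & x - f k \in L.
Proof.
apply: submod_of => [|x y [k kK xk] [l lK yl]|a x [k kK xk]].
- by exists 0; rewrite ?rpred0 // linear0 subr0 rpred0.
- exists (k + l); first by rewrite rpredD.
  by rewrite linearD opprD addrACA rpredD.
- exists (a *: k); first by rewrite rpredZ.
  by rewrite linearZ_LR -scalerBr rpredZ.
Qed.

Lemma sub_add_range M N (f : {linear M -> N}) (L : submodClosed N) :
  exists S : submodClosed N, forall x, x \in S <-> exists y, x - f y \in L.
Proof.
have [S SP] := sub_add_image f (kernel (\0%R : {linear M -> N})) L.
exists S => x; rewrite SP; split=> [[y _]|[y]]; exists y => //.
by rewrite unfold_in.
Qed.

Lemma sub_add_line M (L : submodClosed M) (v : M) :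
  exists S : submodClosed M, forall x, x \in S <-> exists a, x - a *: v \in L.
Proof. exact: sub_add_range (orbit_map v) L. Qed.

Lemma quotmodW M (K : submodClosed M) (T : quotmod K -> Prop) :
  (forall x, T (\pi x)) -> forall u, T u.
Proof. by move=> Tpi u; rewrite -[u]reprK. Qed.

Lemma pi_eq0 M (K : submodClosed M) x : \pi_(quotmod K) x = 0 <-> x \in K.
Proof.
rewrite -{2}(subr0 x) -quotmodP.
by rewrite -[0 in X in X <-> _](linear0 \pi_(quotmod K)).
Qed.

Lemma quotmod_factor M N (K : submodClosed M) (h : {linear M -> N}) :
    (forall x, x \in K -> h x = 0) ->
  exists g : {linear quotmod K -> N}, forall x, g (\pi x) = h x.
Proof.
move=> hK.
have reprE x : h (repr (\pi_(quotmod K) x)) = h x.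
  apply/eqP; rewrite -subr_eq0 -linearB; apply/eqP/hK.
  by apply/quotmodP; rewrite reprK.
have [|g gE] := @linear_of (quotmod K) N (h \o repr).
  move=> a; elim/quotmodW=> x; elim/quotmodW=> y.
  by rewrite -linearZ -linearD /= !reprE linearD linearZ.
by exists g => x; rewrite gE /= reprE.
Qed.

(** * Maximal and small submodules *)

Lemma maximal_subP M (L : submodClosed M) :
  maximal_sub L <->
  proper_sub L /\ forall x y, x \notin L -> exists a, y - a *: x \in L.
Proof.
split=> -[properL maxL]; split=> //.
  move=> x y xL; have [S SP] := sub_add_line L x.
  have [|SL|/(_ y)/SP//] := maxL S.
    by move=> z zL; apply/SP; exists 0; rewrite scale0r subr0.
  case/negP: xL; rewrite -SL; apply/SP; exists 1.
  by rewrite scale1r subrr rpred0.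
move=> N LN; have [[x xN xL]|NL] := pselect (exists2 x, x \in N & x \notin L).
  right=> y; have [a ya] := maxL x y xL.
  by apply: subBK (LN _ ya) _; rewrite rpredZ.
left=> x; apply/idP/idP => [xN|/LN//].
by apply/negPn/negP => xL; apply: NL; exists x.
Qed.

Lemma maximal_preim M N (f : {linear M -> N}) (L : submodClosed N)
    (K : submodClosed M) :
    maximal_sub L -> (forall x, (x \in K) = (f x \in L)) -> proper_sub K ->
  maximal_sub K.
Proof.
move=> /maximal_subP[_ maxL] KE properK; apply/maximal_subP; split=> // x y.
rewrite KE => /maxL-/(_ (f y))[a ya]; exists a.
by rewrite KE linearB linearZ.
Qed.

(** Otherwise the maximal submodule f^-1(L) and the small submodule K would add
    up to the whole module. *)
Lemma small_image_sub_maximal M N (K : submodClosed M) (f : {linear M -> N})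
    (L : submodClosed N) k :
  small_sub K -> maximal_sub L -> k \in K -> f k \in L.
Proof.
move=> smallK maxL kK; apply/negPn/negP => fkL.
have [L' L'E] := preim_sub f L.
have properL' : proper_sub L' by exists k; rewrite L'E.
apply: (smallK L' properL') => y.
have /maximal_subP[_ /(_ k y)] := maximal_preim maxL L'E properL'.
rewrite L'E => /(_ fkL)[a ya].
by exists (a *: k), (y - a *: k); rewrite rpredZ //; split=> //; rewrite subrKC.
Qed.

(** The image of a small submodule is small; stating this with the image spread
    out avoids forming it as a submodule. *)
Lemma small_image_absorb M N (K : submodClosed M) (f : {linear M -> N})
    (L : submodClosed N) :
    small_sub K -> (forall y, exists2 k, k \in K & y - f k \in L) ->
  full_sub L.
Proof.
move=> smallK KL; have [L' L'E] := preim_sub f L.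
have fullL' : full_sub L'.
  move=> x; apply/negPn/negP => xL'; apply: (smallK L'); first by exists x.
  move=> y; have [k kK yk] := KL (f y).
  by exists k, (y - k); split; rewrite ?L'E ?linearB ?subrKC.
by move=> y; have [k _ yk] := KL y; apply: subBK yk _; rewrite -L'E.
Qed.

Lemma small_subI M (K K' : submodClosed M) :
  {subset K' <= K} -> small_sub K -> small_sub K'.
Proof.
move=> K'K smallK L properL sumL; apply: smallK properL _ => x.
by have [y [z [/K'K]]] := sumL x; exists y, z.
Qed.

(** The two factors are absorbed in turn, each along its own inclusion. *)
Lemma small_prod M N (K1 : submodClosed M) (K2 : submodClosed N)
    (K : submodClosed (M * N)%type) :
    small_sub K1 -> small_sub K2 ->
    (forall x, x \in K -> x.1 \in K1 /\ x.2 \in K2) ->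
  small_sub K.
Proof.
move=> small1 small2 K12 L [x0 x0L] sumL.
have [inl [inr inE]] :=
  linear_prod (idfun : {linear (M * N)%type -> (M * N)%type}).
have [L2 L2P] := sub_add_image inr K2 L.
suff fullL : full_sub L by rewrite fullL in x0L.
apply: (@small_image_absorb _ _ _ inr L small2) => y; apply/L2P; move: y.
apply: (@small_image_absorb _ _ _ inl L2 small1) => y.
have [k [l [/K12[k1 k2] lL ->]]] := sumL y.
exists k.1 => //; apply/L2P; exists k.2 => //.
by rewrite {1}[k]inE /= [_ + l]addrC -addrA -addrA -opprD subrr addr0.
Qed.

(** * Krull's theorem and the radical of a module *)

(** Finite generation, phrased without linear combinations. *)
Definition spans M (s : seq M) : Prop :=
  forall L : submodClosed M, {subset s <= L} -> full_sub L.

Lemma sub_maximal_avoiding M (L : submodClosed M) v : v \notin L ->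
  exists N : submodClosed M, [/\ {subset L <= N}, v \notin N &
    forall N' : submodClosed M, {subset N <= N'} -> v \notin N' ->
      {subset N' <= N}].
Proof.
move=> vL.
pose T := {N : submodClosed M | {subset L <= N} /\ v \notin N}.
pose le (N N' : T) := `[< {subset sval N <= sval N'} >].
pose L0 : T := exist _ L (conj (fun _ => id) vL).
have [||F chainF|[N [LN vN]] maxN] := @ZL_preorder T L0 le.
- by move=> N; apply/asboolP.
- by move=> N N' N'' /asboolP h /asboolP h'; apply/asboolP => x /h/h'.
- have [[N0 FN0]|F0] := pselect (exists N : T, F N); last first.
    by exists L0 => N FN; case: F0; exists N.
  have [|x y [N FN xN] [N' FN' yN']|a x [N FN xN]|U UP] :=
    @submod_of M (fun x => exists2 N : T, F N & x \in sval N).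
  + by exists N0; rewrite ?rpred0.
  + have [/asboolP NN'|/asboolP N'N] := chainF _ _ FN FN'.
      by exists N' => //; rewrite rpredD // NN'.
    by exists N => //; rewrite rpredD // N'N.
  + by exists N; rewrite ?rpredZ.
  have LU : {subset L <= U}.
    by move=> x xL; apply/UP; exists N0 => //; have [+ _] := svalP N0; apply.
  have vU : v \notin U.
    by apply/negP => /UP[N _]; have [_ /negP] := svalP N.
  exists (exist _ U (conj LU vU)) => N FN; apply/asboolP => x xN.
  by apply/UP; exists N.
exists N; split=> // N' NN' vN'.
have LN' : {subset L <= N'} by move=> x /LN/NN'.
by have /asboolP := maxN (exist _ N' (conj LN' vN')) (asboolT NN').
Qed.

(** If adding the first generator v to L leaves a proper submodule, v can be put
    into L; otherwise a submodule maximal among those that contain L and avoid v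
    is a maximal submodule, since any larger one contains both L and v. *)
Lemma krull M (s : seq M) (L : submodClosed M) :
    spans s -> proper_sub L ->
  exists2 N : submodClosed M, maximal_sub N & {subset L <= N}.
Proof.
move=> spans_s properL.
have {spans_s} : forall N : submodClosed M,
    {subset L <= N} -> {subset s <= N} -> full_sub N.
  by move=> N _; apply: spans_s.
elim: s L properL => [|v s IHs] L [x xL] spans_s.
  by move: xL; rewrite (spans_s L).
have [S SP] := sub_add_line L v.
have LS : {subset L <= S}.
  by move=> y yL; apply/SP; exists 0; rewrite scale0r subr0.
have vS : v \in S by apply/SP; exists 1; rewrite scale1r subrr rpred0.
have [fullS|/asboolPn/existsp_asboolPn[y /negP yS]] := pselect (full_sub S).
  have vL : v \notin L.
    apply: contra xL => vL; have /SP[a xa] := fullS x.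
    by apply: subBK xa _; rewrite rpredZ.
  have [N [LN vN maxN]] := sub_maximal_avoiding vL; exists N => //.
  split=> [|N' NN']; first by exists v.
  have [vN'|/(maxN _ NN') N'N] := boolP (v \in N'); last first.
    by left=> z; apply/idP/idP; [exact: N'N|exact: NN'].
  right=> z; have /SP[a /LN/NN' za] := fullS z.
  by apply: subBK za _; rewrite rpredZ.
have [||N maxN SN] := IHs S; first by exists y.
- move=> N SN sN; apply: spans_s => z; first by move=> /LS/SN.
  by rewrite inE => /predU1P[->|/sN//]; exact: SN.
- by exists N => // z /LS/SN.
Qed.

Lemma spans_regular : spans [:: 1 : A^o].
Proof.
move=> L L1 a; rewrite -[a]mulr1; apply: (@rpredZ _ _ L a).
by apply: L1; rewrite mem_head.
Qed.

Lemma radical M : exists K : submodClosed M,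
  forall x, x \in K <-> forall L : submodClosed M, maximal_sub L -> x \in L.
Proof.
apply: submod_of => [L _|x y xK yK L maxL|a x xK L maxL].
- exact: rpred0.
- by rewrite rpredD ?xK ?yK.
- by rewrite rpredZ ?xK.
Qed.

(** Every proper submodule of a finitely generated module lies in a maximal one,
    which also contains the radical. *)
Lemma small_radical M (s : seq M) (K : submodClosed M) :
    spans s ->
    (forall x, x \in K ->
       forall L : submodClosed M, maximal_sub L -> x \in L) ->
  small_sub K.
Proof.
move=> spans_s KP L properL sumL.
have [N maxN LN] := krull spans_s properL; have [[x xN] _] := maxN.
have [y [z [/KP/(_ N maxN) yN /LN zN]]] := sumL x => xE.
by case/negP: xN; rewrite xE rpredD.
Qed.

(** The annihilator of a vector modulo a maximal submodule is all of the ring or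
    a maximal left ideal; either way it contains the Jacobson radical. *)
Lemma jacobson_scale_radical M (a : A^o) :
    (forall I : submodClosed A^o, maximal_sub I -> a \in I) ->
  forall (x : M) (L : submodClosed M), maximal_sub L -> (a : A) *: x \in L.
Proof.
move=> aJ x L maxL; have [K KE] := preim_sub (orbit_map x) L.
suff : a \in K by rewrite KE.
apply/negPn/negP => aK; case/negP: (aK); apply: aJ.
by apply: maximal_preim maxL KE _; exists a.
Qed.

End Submodules.

(** * Modules spanned by vectors that generate simple submodules *)

Section SimpleVectors.
Variable A : pzRingType.
Implicit Types M N P : lmodType A.

(** This says that v generates a simple submodule or is 0. Allowing 0 keeps the
    notion stable under homomorphisms. *)
Definition simple_vec M (v : M) : Prop :=
  forall a : A, a *: v = 0 \/ exists b : A, b *: (a *: v) = v.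

Lemma simple_vec_map M N (f : {linear M -> N}) v :
  simple_vec v -> simple_vec (f v).
Proof.
move=> simple_v a; have [av0|[b bav]] := simple_v a; [left|right; exists b].
  by rewrite -linearZ_LR av0 linear0.
by rewrite -!linearZ_LR bav.
Qed.

Lemma simple_vec_mem M (v : M) (L : submodClosed M) a :
  simple_vec v -> v \notin L -> a *: v \in L -> a *: v = 0.
Proof.
move=> /(_ a)[//|[b bav]] /negP vL avL; case: vL.
by rewrite -bav rpredZ.
Qed.

Lemma simple_vec_ann M (v : M) :
  simple_vec v -> v <> 0 -> maximal_sub (kernel (orbit_map v)).
Proof.
have annE (a : A^o) : (a \in kernel (orbit_map v)) = ((a : A) *: v == 0) by [].
move=> simple_v v0; apply/maximal_subP; split.
  by exists (1 : A); rewrite annE scale1r; apply/eqP.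
move=> a b; rewrite annE => /eqP av.
have [//|[c cav]] := simple_v a; exists ((b : A) * c).
rewrite annE scalerBl; apply/eqP/subr0_eq.
suff -> : (((b : A) * c) *: a : A^o) = b * c * a :> A.
  by rewrite -!scalerA cav subrr subr0.
by [].
Qed.

(** A module killed by I is a quotient of copies of A/I: each generator w gives a
    map from A/I that sends 1 to w, and the images of s under these maps span. *)
Lemma spans_killed_by_ideal M (I : submodClosed A^o) (s : seq (quotmod I))
    (t : seq M) :
    (forall v, v \in s -> simple_vec v) -> spans s -> spans t ->
    (forall (a : A^o) (x : M), a \in I -> (a : A) *: x = 0) ->
  exists s' : seq M, (forall v, v \in s' -> simple_vec v) /\ spans s'.
Proof.
move=> simple_s spans_s spans_t IM.
suff [s' [simple_s' s't]] : exists s' : seq M,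
    (forall v, v \in s' -> simple_vec v) /\
    forall L : submodClosed M, {subset s' <= L} -> {subset t <= L}.
  by exists s'; split=> // L s'L; apply/spans_t/s't.
elim: t {spans_t} => [|w t [s' [simple_s' s't]]]; first by exists [::].
have [|h hE] := @quotmod_factor _ _ _ I (orbit_map w).
  by move=> a aI; apply: IM.
exists (map h s ++ s'); split=> [v|L sL].
  rewrite mem_cat => /orP[/mapP[u us ->]|/simple_s'//].
  exact/simple_vec_map/simple_s.
move=> v; rewrite inE => /predU1P[->|]; last first.
  by apply: s't => u us'; apply: sL; rewrite mem_cat us' orbT.
have [K KE] := preim_sub h L.
have /(_ (\pi_(quotmod I) (1 : A^o))) : full_sub K.
  by apply: spans_s => u us; rewrite KE; apply: sL; rewrite mem_cat map_f.
by rewrite KE hE /= orbit_map1.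
Qed.

Lemma simple_generator M (x : M) :
  simple_module M -> x <> 0 -> forall y, exists a : A, y = a *: x.
Proof.
move=> [_ simpleM] x0.
have [||c _ [a ->]|L LP] := @submod_of _ M (fun y => exists a : A, y = a *: x).
- by exists 0; rewrite scale0r.
- by move=> _ _ [a ->] [b ->]; exists (a + b); rewrite scalerDl.
- by exists (c * a); rewrite scalerA.
have [zeroL|fullL] := simpleM L; last by move=> y; apply/LP.
by case: x0; apply: zeroL; apply/LP; exists 1; rewrite scale1r.
Qed.

Lemma simple_module_vec M (x : M) : simple_module M -> simple_vec x.
Proof.
move=> simpleM a; have [->|/eqP ax0] := eqVneq (a *: x) 0; first by left.
by right; have [b xE] := simple_generator simpleM ax0 x; exists b.
Qed.

Lemma quotmod_maximal_simple M (L : submodClosed M) :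
  maximal_sub L -> simple_module (quotmod L).
Proof.
move=> /maximal_subP[[x xL] maxL]; split.
  by exists (\pi_(quotmod L) x); apply/eqP => /pi_eq0; apply/negP.
move=> N.
have [[u uN /eqP u0]|N0] := pselect (exists2 u, u \in N & u != 0); last first.
  by left=> u uN; apply/eqP/negPn/negP => u0; apply: N0; exists u.
right; elim/quotmodW: u uN u0 => y yN y0; elim/quotmodW=> z.
have [|a /pi_eq0] := maxL y z; first by apply/negP => /pi_eq0.
by rewrite linearB linearZ_LR => /subr0_eq ->; rewrite rpredZ.
Qed.

(** * Covers of sums of simple modules *)

Definition covered_by (C : lmodType A -> Prop) M : Prop :=
  exists (P : lmodType A) (f : {linear P -> M}),
    [/\ epimorphism f, C P & small_sub (kernel f)].

Section Cover.
Variable C : lmodType A -> Prop.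
Hypothesis C_zero : exists Z : lmodType A, C Z /\ forall z : Z, z = 0.
Hypothesis C_prod : forall P Q, C P -> C Q -> C (P * Q)%type.
Hypothesis C_simple : forall M, simple_module M -> covered_by C M.

(** Growing the family one vector at a time: a simple vector already in B + im f
    is skipped, any other one generates a line that meets B + im f trivially, so
    adding a cover of this line keeps the kernel a product of small kernels. *)
Lemma cover_complement M (B : submodClosed M) (s : seq M) :
    (forall v, v \in s -> simple_vec v) ->
  exists (P : lmodType A) (f : {linear P -> M}),
    [/\ C P, small_sub (kernel f), forall p, f p \in B -> f p = 0 &
        forall v, v \in s -> exists p, v - f p \in B].
Proof.
elim: s => [_|v s IHs simple_vs].
  have [Z [CZ Z0]] := C_zero; exists Z, \0%R; split=> // L [z].
  by rewrite [z]Z0 rpred0.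
have [w ws|P [f [CP small_f fB sf]]] := IHs.
  by apply: simple_vs; rewrite inE ws orbT.
have simple_v : simple_vec v by apply: simple_vs; rewrite mem_head.
have [D DP] := sub_add_range f B.
have [/DP[p vp]|vD] := boolP (v \in D).
  exists P, f; split=> // w; rewrite inE => /predU1P[->|/sf//]; by exists p.
have v0 : v <> 0 by move=> v0; case/negP: vD; rewrite v0 rpred0.
have [h hE] :=
  @quotmod_factor _ _ _ (kernel (orbit_map v)) (orbit_map v)
    (fun a => elimT eqP).
have [P0 [f0 [f0_epi CP0 small_f0]]] :=
  C_simple (quotmod_maximal_simple (simple_vec_ann simple_v v0)).
have h0 u : h u \in D -> u = 0.
  elim/quotmodW: u => a; rewrite hE => /(simple_vec_mem simple_v vD) av0.
  by apply/pi_eq0/eqP.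
pose F : {linear (P * P0)%type -> M} := (f \o fst) \+ ((h \o f0) \o snd).
have FE p : F p = f p.1 + h (f0 p.2) by [].
have FB p : F p \in B -> F p = 0 /\ (f p.1 = 0 /\ f0 p.2 = 0).
  rewrite FE => FpB; have f0p0 : f0 p.2 = 0.
    by apply: h0; apply/DP; exists (- p.1); rewrite linearN opprK addrC.
  by move: FpB; rewrite f0p0 linear0 addr0 => /fB.
exists (P * P0)%type, F; split=> [||p /FB[]//|w].
- exact: C_prod.
- apply: small_prod small_f small_f0 _ => p.
  rewrite [_ \in _]unfold_in => /eqP Fp.
  have [|_ [fp f0p]] := FB p; first by rewrite Fp rpred0.
  by rewrite !unfold_in fp f0p eqxx.
rewrite inE => /predU1P[->|/sf[p wp]].
  have [p0 f0p0] := f0_epi (\pi_(quotmod _) (1 : A^o)); exists (0, p0).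
  by rewrite FE f0p0 hE /= orbit_map1 linear0 add0r subrr rpred0.
by exists (p, 0); rewrite FE !linear0 addr0.
Qed.

(** The map h carries a complement of its kernel isomorphically onto its image,
    so it suffices to cover this complement. *)
Lemma cover_image M N (h : {linear M -> N}) (s : seq M) :
    (forall v, v \in s -> simple_vec v) -> spans s ->
  exists (P : lmodType A) (f : {linear P -> M}),
    [/\ C P, small_sub (kernel (h \o f)) & forall x, exists p, h (f p) = h x].
Proof.
move=> simple_s spans_s.
have [P [f [CP small_f fB sf]]] := cover_complement (kernel h) simple_s.
exists P, f; split=> // [|x].
  apply: small_subI small_f => p hfp; rewrite unfold_in.
  by apply/eqP/fB.
have [D DP] := sub_add_range f (kernel h).
have /DP[p xp] : x \in D by apply: spans_s => v /sf[p vp]; apply/DP; exists p.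
by exists p; move: xp; rewrite unfold_in linearB => /eqP/subr0_eq.
Qed.

End Cover.
End SimpleVectors.

(** * Spanning quotients of the ring by simple vectors *)

Section Projective.
Variable A : pzRingType.
Implicit Types M N P : lmodType A.

(** If the simple vectors of A/J did not span, their span, pulled back to A, would
    lie in a maximal ideal I; but the class modulo J of an element c outside I
    with Ic inside J is a simple vector, since Ic vanishes modulo J. *)
Lemma spans_simple_quotient (J : submodClosed A^o) :
    (forall I : submodClosed A^o, maximal_sub I ->
       exists2 c : A^o, c \notin I &
         forall y : A^o, y \in I -> (y : A) *: c \in J) ->
  exists s : seq (quotmod J), (forall v, v \in s -> simple_vec v) /\ spans s.
Proof.
move=> coatom.
pose socle (x : quotmod J) := exists s : seq (quotmod J),
  (forall v, v \in s -> simple_vec v) /\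
  forall L : submodClosed (quotmod J), {subset s <= L} -> x \in L.
have [||a x [s [simple_s sx]]|S SP] := @submod_of _ _ socle.
- by exists [::]; split=> // L _; rewrite rpred0.
- move=> x y [s [simple_s sx]] [t [simple_t ty]]; exists (s ++ t); split.
    by move=> v; rewrite mem_cat => /orP[/simple_s|/simple_t].
  move=> L stL; rewrite rpredD ?sx ?ty // => v vst; apply: stL.
    by rewrite mem_cat vst.
  by rewrite mem_cat vst orbT.
- by exists s; split=> // L /sx; exact: rpredZ.
suff /SP[s [simple_s s1]] : \pi_(quotmod J) (1 : A^o) \in S.
  exists s; split=> // L /s1 L1; elim/quotmodW => a.
  suff -> : \pi_(quotmod J) a = (a : A) *: \pi_(quotmod J) (1 : A^o).
    by rewrite rpredZ.
  by rewrite -linearZ_LR /= -[a in LHS]mulr1.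
apply/negPn/negP => S1.
have [S' S'E] := preim_sub \pi_(quotmod J) S.
have [|I maxI S'I] := krull (@spans_regular A) (_ : proper_sub S').
  by exists 1; rewrite S'E.
have [c /negP cI IcJ] := coatom I maxI; apply: cI; apply: S'I.
rewrite S'E; apply/SP; exists [:: \pi c].
split=> [_ /[!inE] /eqP->|L]; last by apply; rewrite mem_head.
move=> a; have [aI|aI] := boolP ((a : A^o) \in I).
  by left; rewrite -linearZ_LR; apply/pi_eq0/IcJ.
have /maximal_subP[_ /(_ (a : A^o) (1 : A^o) aI)[b abI]] := maxI.
right; exists b; apply/esym/subr0_eq.
rewrite -(linearZ_LR _ a) -(linearZ_LR _ b) -linearB.
apply/pi_eq0; move: (IcJ _ abI); congr (_ \in J).
by rewrite [LHS]scalerBl scale1r scalerA.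
Qed.

(** * Projective covers *)

Definition projective P : Prop :=
  forall M N (f : {linear M -> N}) (h : {linear P -> N}), epimorphism f ->
  exists g : {linear P -> M}, forall p, f (g p) = h p.

Lemma projective_zero :
  exists Z : lmodType A, projective Z /\ forall z : Z, z = 0.
Proof.
exists 'rV[A]_0; split=> [M N f h _|z]; last exact: thinmx0.
by exists \0 => p; rewrite [p]thinmx0 !linear0.
Qed.

Lemma projective_prod P Q :
  projective P -> projective Q -> projective (P * Q)%type.
Proof.
move=> projP projQ M N f h f_epi; have [h1 [h2 hE]] := linear_prod h.
have [[g1 g1E] [g2 g2E]] := (projP _ _ f h1 f_epi, projQ _ _ f h2 f_epi).
exists ((g1 \o fst) \+ (g2 \o snd)) => p.
by rewrite hE /= linearD g1E g2E.
Qed.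

Local Notation idem_module e := (quotmod (kernel (orbit_map (e : A^o)))).

(** The quotient by the kernel stands for the principal ideal generated by the
    idempotent e, a retract of the regular module. *)
Lemma projective_idempotent (e : A) :
  e * e = e -> projective (idem_module e).
Proof.
move=> ee M N f h f_epi.
have [m fm] := f_epi (h (\pi_(idem_module e) (1 : A^o))).
have [|g gE] := @quotmod_factor _ _ _ (kernel (orbit_map (e : A^o)))
    (orbit_map (e *: m)).
  move=> a; rewrite unfold_in => /eqP ae0.
  by rewrite /= /orbit_map scalerA [_ * _]ae0 scale0r.
exists g; elim/quotmodW => a; rewrite gE /orbit_map !linearZ_LR /= fm.
rewrite -!linearZ_LR; congr (h _); apply/quotmodP.
rewrite unfold_in /orbit_map; apply/eqP.
suff -> : (a : A) *: (e *: (1 : A^o)) - a = a * e - a :> A.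
  by rewrite [LHS]mulrBl -mulrA ee subrr.
by rewrite /GRing.scale /= mulr1.
Qed.

(** With I the annihilator of a generator x, the map sending a to a e x covers M:
    it is onto since e is outside I, and its kernel is small since I e lies in the
    Jacobson radical. *)
Lemma simple_projective_cover M :
    (forall I : submodClosed A^o, maximal_sub I ->
       exists e : A^o, [/\ (e : A) * e = e, e \notin I &
         forall y I', y \in I -> maximal_sub I' -> (y : A) *: e \in I']) ->
  simple_module M -> covered_by projective M.
Proof.
move=> idem simpleM; have [[x /eqP x0] _] := simpleM.
have [e [ee eI eJ]] :=
  idem _ (simple_vec_ann (simple_module_vec x simpleM) x0).
have ex0 : (e : A) *: x <> 0 by move=> /eqP ex0; case/negP: eI.
have [|f fE] := @quotmod_factor _ _ _ (kernel (orbit_map e))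
    (orbit_map ((e : A) *: x)).
  move=> a; rewrite unfold_in => /eqP ae0.
  by rewrite /= /orbit_map scalerA [_ * _]ae0 scale0r.
exists (idem_module e), f; split.
- move=> y; have [a ->] := simple_generator simpleM ex0 y.
  by exists (\pi_(idem_module e) (a : A^o)); rewrite fE.
- exact: projective_idempotent.
apply: (@small_radical _ _ [:: \pi_(idem_module e) (1 : A^o)]) => [L L1|].
  elim/quotmodW => a.
  suff -> : \pi_(idem_module e) a = (a : A) *: \pi_(idem_module e) (1 : A^o).
    by rewrite rpredZ // L1 ?mem_head.
  by rewrite -linearZ_LR /= -[a in LHS]mulr1.
elim/quotmodW => a; rewrite unfold_in fE => /eqP aex0 L maxL.
have -> : \pi_(idem_module e) a
    = ((a : A) * e : A) *: \pi_(idem_module e) (1 : A^o).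
  rewrite -linearZ_LR; apply/quotmodP.
  rewrite unfold_in /orbit_map; apply/eqP.
  suff -> : (a : A) - ((a : A) * e) *: (1 : A^o) = a - a * e :> A.
    by rewrite [LHS]mulrBl -mulrA ee subrr.
  by rewrite /GRing.scale /= mulr1.
apply: jacobson_scale_radical maxL => I maxI.
have -> : (a : A) * e = ((a : A) * e) *: (e : A^o) :> A.
  by rewrite -[RHS]mulrA ee.
apply: eJ maxI; rewrite unfold_in /= /orbit_map -scalerA.
by apply/eqP.
Qed.

(** A cover of M modulo its radical lifts to M because its source is projective,
    and the lift is onto because the radical of M is small. *)
Lemma projective_cover_fin_generated M (J : submodClosed A^o)
    (s : seq (quotmod J)) (t : seq M) :
    (forall x (I : submodClosed A^o), x \in J -> maximal_sub I -> x \in I) ->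
    (forall N, simple_module N -> covered_by projective N) ->
    (forall v, v \in s -> simple_vec v) -> spans s -> spans t ->
  covered_by projective M.
Proof.
move=> Jrad simple_cover simple_s spans_s spans_t; have [K KP] := radical M.
have spans_pit : spans (map \pi_(quotmod K) t).
  move=> L tL; elim/quotmodW => x; have [L' L'E] := preim_sub \pi_(quotmod K) L.
  rewrite -L'E; apply: spans_t => v vt; rewrite L'E; apply: tL; exact: map_f.
have [|s' [simple_s' spans_s']] :=
  spans_killed_by_ideal simple_s spans_s spans_pit.
  move=> a + aJ; elim/quotmodW => x; rewrite -linearZ_LR; apply/pi_eq0/KP => L.
  by apply: jacobson_scale_radical => I; exact: Jrad.
have [P [f [projP small_f f_epi]]] := cover_image projective_zero
  projective_prod simple_cover (idfun : {linear quotmod K -> quotmod K})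
  simple_s' spans_s'.
have [|g gE] := projP _ _ \pi_(quotmod K) f.
  by elim/quotmodW=> x; exists x.
exists P, g; split=> //; last first.
  apply: small_subI small_f => p; rewrite !unfold_in -gE => /eqP->.
  by rewrite linear0.
have [L LP] := sub_add_range g (kernel (idfun : {linear M -> M})).
suff fullL : full_sub L.
  move=> y; have /LP[p] := fullL y; rewrite unfold_in /= => /eqP/subr0_eq ->.
  by exists p.
apply: (@small_image_absorb _ _ _ K idfun).
  by apply: small_radical spans_t _ => x /KP.
move=> y; have [p fp] := f_epi (\pi_(quotmod K) y); exists (y - g p).
  by apply/pi_eq0; rewrite linearB /= gE [f p]fp subrr.
by apply/LP; exists p; rewrite unfold_in /= subKr subrr.
Qed.

End Projective.

(** * Max-projective modules *)

Section MaxProjective.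
Variable R : pzRingType.
Implicit Types M P Q : rmodType R.

Lemma projective_max_projective P : projective P -> max_projective P.
Proof.
move=> projP I _ h; have [|g gE] := projP _ _ \pi_(quotmod I) h.
  by elim/quotmodW=> x; exists x.
by exists g => x; rewrite gE.
Qed.

Lemma max_projective_zero :
  exists Z : rmodType R, max_projective Z /\ forall z : Z, z = 0.
Proof.
have [Z [projZ Z0]] := projective_zero R^c.
by exists Z; split=> //; exact: projective_max_projective.
Qed.

Lemma max_projective_prod P Q :
  max_projective P -> max_projective Q -> max_projective (P * Q)%type.
Proof.
move=> maxP maxQ I maxI h; have [h1 [h2 hE]] := linear_prod h.
have [[g1 g1E] [g2 g2E]] := (maxP I maxI h1, maxQ I maxI h2).
exists ((g1 \o fst) \+ (g2 \o snd)) => p.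
by rewrite hE g1E g2E -linearD.
Qed.

(** The lift is built one simple vector v of the target at a time: the
    coefficient of v is determined up to the annihilator of v, a maximal ideal,
    hence is a homomorphism into a simple quotient of the ring, which lifts. *)
Lemma max_projective_lift M P (f : {linear R^c^o -> M}) (h : {linear P -> M})
    (s : seq M) :
    max_projective P -> epimorphism f ->
    (forall v, v \in s -> simple_vec v) -> spans s ->
  exists g : {linear P -> R^c^o}, forall p, h p = f (g p).
Proof.
move=> maxP f_epi simple_s spans_s.
pose zero := kernel (idfun : {linear M -> M}) : submodClosed M.
suff [g gE] : exists g : {linear P -> R^c^o}, forall p, h p - f (g p) \in zero.
  by exists g => p; apply/subr0_eq/eqP/gE.
have {spans_s} : forall L : submodClosed M,
    {subset zero <= L} -> {subset s <= L} -> full_sub L.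
  by move=> L _; apply: spans_s.
elim: s zero simple_s => [|v s IHs] B simple_vs spans_vs.
  by exists \0 => p; apply: spans_vs.
have simple_v : simple_vec v by apply: simple_vs; rewrite mem_head.
have [D DP] := sub_add_line B v.
have BD : {subset B <= D}.
  by move=> x xB; apply/DP; exists 0; rewrite scale0r subr0.
have vD : v \in D by apply/DP; exists 1; rewrite scale1r subrr rpred0.
have [w ws|L DL sL|g gE] := IHs D.
- by apply: simple_vs; rewrite inE ws orbT.
- apply: spans_vs => w; first by move=> /BD/DL.
  by rewrite inE => /predU1P[->|/sL//]; exact: DL.
have [vB|vB] := boolP (v \in B).
  exists g => p; have /DP[a pa] := gE p.
  by apply: subBK pa _; rewrite rpredZ.
have v0 : v <> 0 by move=> v0; case/negP: vB; rewrite v0 rpred0.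
pose I := kernel (orbit_map v).
have [c cE] := choice (fun p => (DP _).1 (gE p)).
have coefE (a : R^c^o) : (a : R^c) *: v \in B -> a \in I.
  by move=> /(simple_vec_mem simple_v vB) av0; rewrite unfold_in; apply/eqP.
have [|k kE] := @linear_of _ P (quotmod I)
    (fun p => \pi_(quotmod I) (c p : R^c^o)).
  move=> a p q; rewrite -linearZ_LR -linearD; apply/quotmodP/coefE.
  have cancel x y z t w :
      (a *: (x - z) + (y - t)) - (a *: x + y - w) = w - (a *: z + t) :> M.
    by rewrite scalerBr addrACA -opprD opprB [LHS]addrC addrA subrK.
  have hg : h (a *: p + q) - f (g (a *: p + q))
      = a *: (h p - f (g p)) + (h q - f (g q)).
    by rewrite (linearP h) (linearP g) (linearP f) scalerBr opprD addrACA.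
  have := subB (rpredD (rpredZ a (cE p)) (cE q)) (cE (a *: p + q)).
  rewrite hg cancel; congr (_ \in B).
  by rewrite [RHS]scalerBl; congr (_ - _); rewrite [RHS]scalerDl scalerA.
have [l lE] := maxP I (simple_vec_ann simple_v v0) k.
have [d dv] := f_epi v.
exists (g \+ (orbit_map d \o l)) => p.
rewrite linearD opprD addrA /= [f (orbit_map d _)]linearZ_LR dv.
suff -> : (l p : R^c) *: v = c p *: v by [].
have : \pi_(quotmod I) (c p : R^c^o) = \pi_(quotmod I) (l p) by rewrite -kE lE.
move=> /quotmodP; rewrite unfold_in => /eqP; rewrite /orbit_map.
by rewrite [X in X = _]scalerBl => /subr0_eq.
Qed.

(** * The Jacobson radical *)

(** Right inverses come from Krull's theorem. A right inverse y of x is itself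
    congruent to 1 modulo the radical, so it has a right inverse too, which must
    be x. *)
Lemma jacobson_left_inverse (x : R) :
  (1 - x : R) \in @jacobson R -> exists y : R, y * x = 1.
Proof.
have right_inverse (z : R) :
    (1 - z : R) \in @jacobson R -> exists y : R, z * y = 1.
  move=> zJ; have [L LP] :=
    sub_add_line (kernel (idfun : {linear R^c^o -> R^c^o})) (z : R^c^o).
  suff fullL : full_sub L.
    have /LP[y] := fullL (1 : R).
    by rewrite unfold_in => /eqP/subr0_eq ->; exists y.
  apply: contrapT => /asboolPn/existsp_asboolPn[t /negP tL].
  have [|I maxI LI] := krull (@spans_regular R^c) (_ : proper_sub L).
    by exists t.
  have [[w /negP wI] _] := maxI; apply: wI; move: w.
  apply: (@spans_regular R^c I) => _ /[!inE] /eqP ->.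
  rewrite -[X in X \in I](subrK (z : R^c^o)) rpredD //.
    by have /jacobsonP := zJ; apply.
  apply: LI; apply/LP; exists 1; rewrite scale1r subrr; exact: rpred0.
move=> xJ; have [y xy] := right_inverse x xJ.
have [|w yw] := right_inverse y.
  suff -> : 1 - y = - (1 - x) * y :> R by apply: jacobson_mulr; rewrite rpredN.
  by rewrite mulNr mulrBl mul1r xy opprB.
by exists y; suff -> : x = w by []; rewrite -[x]mulr1 -yw mulrA xy mul1r.
Qed.

Lemma quot_jacobsonP (x y : R) :
  \pi_(quot_jacobson R) x = \pi_(quot_jacobson R) y <->
  (x - y : R) \in @jacobson R.
Proof. exact: (@quotmodP _ _ (@jacobson R : right_ideal R) x y). Qed.

Lemma quot_jacobson_eq0 (x : R) :
  \pi_(quot_jacobson R) x = 0 <-> x \in @jacobson R.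
Proof. exact: (@pi_eq0 _ _ (@jacobson R : right_ideal R) x). Qed.

Lemma pi_quot_jacobsonM (x y : R) : \pi_(quot_jacobson R) (x * y) =
  \pi_(quot_jacobson R) x * \pi_(quot_jacobson R) y.
Proof. exact: pi_quot_jacobson_mul. Qed.

Lemma quot_jacobson_scale (a : R) (u : quot_jacobson R) :
  (a : R^c) *: (u : quotmod (@jacobson R : right_ideal R)) =
  u * \pi_(quot_jacobson R) a.
Proof.
elim/quot_jacobsonW: u => x.
rewrite -pi_quot_jacobsonM.
by rewrite -[LHS](linearZ_LR \pi_(quotmod (@jacobson R : right_ideal R))).
Qed.

End MaxProjective.

(** * Semiperfect rings *)

Section Semiperfect.
Variable R : pzRingType.

Local Notation J := (@jacobson R : right_ideal R).

(** Writing 1 = y + z along a complement of I/J in R/J, the component z is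
    idempotent, and z(I/J) lies both in I/J and in the complement; e lifts z. *)
Lemma semiperfect_local_idempotent (I : right_ideal R) :
    semiperfect R -> maximal_sub I ->
  exists e : R, [/\ e * e = e, (e : R^c^o) \notin I &
    forall y : R, (y : R^c^o) \in I -> (e * y : R) \in J].
Proof.
move=> [semisimple lift] maxI.
have [||a u [i iI ->]|N NP] := @submod_of _ ((quot_jacobson R)^c^o : rmodType _)
    (fun u => exists2 i : R, (i : R^c^o) \in I & u = \pi_(quot_jacobson R) i).
- by exists 0; [exact: rpred0 | exact: esym (linear0 \pi_(quotmod J))].
- move=> _ _ [i iI ->] [j jI ->]; exists (i + j); first exact: rpredD.
  by rewrite pi_quot_jacobsonD.
- elim/quot_jacobsonW: a => a; exists (i * a).
    exact: (@rpredZ _ _ I a _ iI).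
  by rewrite (pi_quot_jacobson_mul i a).
have [N' [sumN NN']] := semisimple N.
have [y [z [yN zN' yz]]] := sumN (1 : quot_jacobson R).
have mulN (L : right_ideal (quot_jacobson R)) (u v : quot_jacobson R) :
    (u : (quot_jacobson R)^c^o) \in L -> (u * v : quot_jacobson R) \in L.
  exact: (@rpredZ _ _ L v).
have zE : z = 1 - y :> quot_jacobson R by rewrite -[LHS](addKr y) -yz addrC.
have zy0 : (z : quot_jacobson R) * y = 0.
  apply: NN'; last exact: mulN.
  by rewrite zE mulrBl mul1r; apply: subB => //; exact: mulN.
have zz : (z : quot_jacobson R) * z = z.
  by rewrite {2}zE mulrBr mulr1 zy0 subr0.
have piN (i : R) : (i : R^c^o) \in I -> (\pi_(quot_jacobson R) i) \in N.
  by move=> iI; apply/NP; exists i.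
have [e [ee ez]] := lift z zz; exists e; split=> // [|i iI].
  apply/negP => eI; have z0 : z = 0 by apply: NN' zN'; rewrite -ez piN.
  have /NP[i iI y1] := yN; have [[x /negP xI] _] := maxI; apply: xI; move: x.
  apply: (@spans_regular R^c I) => _ /[!inE] /eqP ->.
  apply: subBK (iI); have /jacobsonP/(_ I maxI) : (1 - i : R) \in J.
    by apply/quot_jacobsonP; rewrite -y1 -[y]addr0 -z0 -yz.
  by [].
apply/quot_jacobson_eq0/NN'.
  rewrite pi_quot_jacobsonM ez zE mulrBl mul1r.
  by apply: subB; [exact: piN | exact: mulN].
rewrite pi_quot_jacobsonM ez; exact: mulN.
Qed.

Lemma semiperfect_projective_cover (M : rmodType R) :
  semiperfect R -> fin_generated M -> covered_by (@projective R^c) M.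
Proof.
move=> semiperfectR [n [v vE]].
have [|s [simple_s spans_s]] := @spans_simple_quotient R^c J.
  move=> I /(semiperfect_local_idempotent semiperfectR)[e [_ eI IeJ]].
  by exists e => // y /IeJ.
apply: (projective_cover_fin_generated (t := codom v)) simple_s spans_s _.
- by move=> x I /jacobsonP; apply.
- move=> N; apply: simple_projective_cover => I maxI.
  have [e [ee eI IeJ]] := semiperfect_local_idempotent semiperfectR maxI.
  by exists e; split=> // y I' /IeJ/jacobsonP; apply.
- move=> L vL x; have [c ->] := vE x; apply: rpred_sum => i _.
  by rewrite rpredZ // vL // codom_f.
Qed.

(** Composing the cover of R/I with a lift of it to R yields an element c whose
    class generates R/I; it sends I into the image of the small kernel. *)
Lemma max_projective_cover_coatom (I : right_ideal R) :
    (forall M : rmodType R, simple_module M -> has_max_projective_cover M) ->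
    maximal_sub I ->
  exists2 c : R^c^o, c \notin I &
    forall y : R^c^o, y \in I -> (y : R^c) *: c \in J.
Proof.
move=> simple_cover maxI.
have [P [f [f_epi maxP small_f]]] :=
  simple_cover _ (quotmod_maximal_simple maxI).
have [g gE] := maxP I maxI f.
have [x fx] := f_epi (\pi_(quotmod I) (1 : R^c^o)).
exists (g x) => [|y yI].
  apply/negP => /pi_eq0; rewrite -gE fx => /pi_eq0 I1.
  have [[w /negP wI] _] := maxI; apply: wI; move: w.
  by apply: (@spans_regular R^c I) => _ /[!inE] /eqP ->.
apply/jacobsonP => I' maxI'; rewrite -linearZ_LR.
apply: small_image_sub_maximal small_f maxI' _.
rewrite unfold_in linearZ_LR fx -linearZ_LR; apply/eqP/pi_eq0.
suff -> : (y : R^c) *: (1 : R^c^o) = y by [].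
exact: mulr1 (y : R^c).
Qed.

Section SimpleCovers.
Hypothesis simple_cover :
  forall M : rmodType R, simple_module M -> has_max_projective_cover M.

Let spans_simple : exists s : seq (quotmod J),
  (forall v, v \in s -> simple_vec v) /\ spans s.
Proof.
by apply: spans_simple_quotient => I; exact: max_projective_cover_coatom.
Qed.

(** The complement is found among R-submodules; R acts on R/J through the ring
    R/J, so it is a right ideal of that ring. *)
Lemma simple_cover_semisimple : semisimple_ring (quot_jacobson R).
Proof.
move=> N; have [s [simple_s spans_s]] := spans_simple.
have [||a u uN|B BE] := @submod_of _ (quotmod J)
    (fun u => (u : (quot_jacobson R)^c^o) \in N).
- exact: rpred0.
- by move=> u v; exact: (@rpredD _ N).
- rewrite quot_jacobson_scale.
  exact: (@rpredZ _ _ N (\pi_(quot_jacobson R) a) u uN).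
have [P [f [_ _ fB sf]]] := cover_complement (@max_projective_zero R)
  (@max_projective_prod R) simple_cover B simple_s.
have [||a _ [p ->]|N' N'P] := @submod_of _ ((quot_jacobson R)^c^o : rmodType _)
    (fun u => exists p, u = f p).
- by exists 0; rewrite linear0.
- by move=> _ _ [p ->] [q ->]; exists (p + q); rewrite linearD.
- elim/quot_jacobsonW: a => a; exists ((a : R^c) *: p).
  by rewrite linearZ_LR quot_jacobson_scale.
exists N'; split=> [u|u uN /N'P[p uE]]; last first.
  by rewrite uE; apply: fB; apply/BE; rewrite -uE.
have [D DP] := sub_add_range f B.
have /DP[p up] : (u : quotmod J) \in D.
  by apply: spans_s => v /sf[p vp]; apply/DP; exists p.
exists ((u : quotmod J) - f p), (f p); split; first exact/BE.
  by apply/N'P; exists p.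
by rewrite subrK.
Qed.

(** Left multiplication by u is an endomorphism of the right module R/J. Covers of
    its image and of the image of 1 - u add up to a cover P of R/J, through which
    the projection of R factors by a map onto P. Since P is max-projective, this
    map is injective as well, and it carries the splitting of P back to an
    idempotent of R above u. *)
Lemma simple_cover_idempotents_lift : idempotents_lift R.
Proof.
move=> u uu; have [s [simple_s spans_s]] := spans_simple.
have mul_linear (w : quot_jacobson R) :
    exists f : {linear quotmod J -> quotmod J},
      forall x, f x = w * (x : quot_jacobson R).
  apply: linear_of => a x y; rewrite !quot_jacobson_scale.
  by rewrite [LHS]mulrDr mulrA.
have [lu luE] := mul_linear u; have [lv lvE] := mul_linear (1 - u).
have cover_im (h : {linear quotmod J -> quotmod J}) :=
  cover_image (@max_projective_zero R) (@max_projective_prod R) simple_cover h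
    simple_s spans_s.
have [P1 [f1 [maxP1 small1 im1]]] := cover_im lu.
have [P2 [f2 [maxP2 small2 im2]]] := cover_im lv.
have luu x : lu (lu x) = lu x by rewrite !luE mulrA uu.
have luv x : lu (lv x) = 0 by rewrite luE lvE mulrA mulrBr mulr1 uu subrr mul0r.
have luv1 x : x = lu x + lv x by rewrite luE lvE -[RHS]mulrDl addrC subrK mul1r.
pose F : {linear (P1 * P2)%type -> quotmod J} :=
  (lu \o f1 \o fst) \+ (lv \o f2 \o snd).
have FE p : F p = lu (f1 p.1) + lv (f2 p.2) by [].
have luF p : lu (F p) = lu (f1 p.1) by rewrite FE linearD luu luv addr0.
have F_epi x : exists p, F p = x.
  have [[p1 p1E] [p2 p2E]] := (im1 x, im2 x); exists (p1, p2).
  by rewrite FE p1E p2E -luv1.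
have small_F : small_sub (kernel F).
  apply: small_prod small1 small2 _ => p; rewrite [_ \in _]unfold_in => /eqP Fp.
  have lu0 : lu (f1 p.1) = 0 by rewrite -luF Fp linear0.
  by move: Fp; rewrite FE lu0 add0r !unfold_in /= lu0 => ->; rewrite eqxx.
have maxP : max_projective (P1 * P2)%type by exact: max_projective_prod.
have [p0 Fp0] := F_epi (\pi_(quotmod J) (1 : R^c^o)).
have Fscale (a : R^c^o) : F ((a : R^c) *: p0) = \pi_(quotmod J) a.
  rewrite linearZ_LR Fp0 -linearZ_LR; congr (\pi _).
  exact: mulr1 (a : R^c).
(* The line of p0 together with the small kernel of F is everything. *)
have p0_gen p : exists a : R^c, p = a *: p0.
  have [L LP] :=
    sub_add_line
      (kernel (idfun : {linear (P1 * P2)%type -> (P1 * P2)%type})) p0.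
  suff /(_ p)/LP[a] : full_sub L.
    by rewrite unfold_in => /eqP/subr0_eq ->; exists a.
  apply: (@small_image_absorb _ _ _ (kernel F) idfun L small_F) => q.
  have [a aE] : exists a : R^c^o, \pi_(quotmod J) a = F q.
    by exists (repr (F q)); rewrite reprK.
  exists (q - (a : R^c) *: p0).
    by rewrite unfold_in linearB Fscale aE subrr.
  by apply/LP; exists a; rewrite unfold_in /= subKr subrr.
have [|g gE] :=
  max_projective_lift F maxP (f := \pi_(quotmod J)) _ simple_s spans_s.
  by elim/quotmodW=> x; exists x.
(* g p0 is congruent to 1 modulo J. *)
have [b bg] : exists b : R, b * (g p0 : R) = 1.
  apply: jacobson_left_inverse; apply/(quotmodP J (1 : R^c^o) (g p0)).
  by rewrite -Fp0 gE.
have p0_free (a : R) : (a : R^c) *: p0 = 0 -> a = 0.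
  move=> ap0; have : g ((a : R^c) *: p0) = 0 by rewrite ap0 linear0.
  rewrite linearZ_LR => ga0; have {ga0} ga0 : (g p0 : R) * a = 0 by [].
  by rewrite -[a]mul1r -bg -mulrA ga0 mulr0.
have [e eE] := p0_gen (p0.1, 0).
have ep1 : e *: p0.1 = p0.1 by rewrite -[LHS]/((e *: p0).1) -eE.
exists e; split.
  apply/subr0_eq/p0_free; rewrite [LHS]scalerBl.
  suff -> : ((e : R) * (e : R) : R^c) *: p0 = e *: p0 by rewrite subrr.
  rewrite -[LHS](scalerA e e) -eE; congr pair; first exact: ep1.
  exact: scaler0.
have -> : \pi_(quot_jacobson R) (e : R) = \pi_(quotmod J) (e : R^c^o) by [].
rewrite -Fscale -eE FE linear0 linear0 addr0 /= -(luF p0) luE Fp0.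
exact: mulr1.
Qed.

End SimpleCovers.
End Semiperfect.

Theorem proposition9 (R : pzRingType) :
  [<-> semiperfect R;
       forall M : rmodType R, fin_generated M -> has_max_projective_cover M;
       forall M : rmodType R, cyclic_module M -> has_max_projective_cover M;
       forall M : rmodType R, simple_module M -> has_max_projective_cover M].
Proof.
tfae=> [semiperfectR M fgM|fg_cover M [v vE]|cyclic_cover M simpleM
  |simple_cover].
- have [P [f [f_epi projP small_f]]] :=
    semiperfect_projective_cover semiperfectR fgM.
  by exists P, f; split=> //; exact: projective_max_projective.
- apply: fg_cover; exists 1%N, (fun _ => v) => x; have [a ->] := vE x.
  by exists (fun _ => a); rewrite big_ord1.
- apply: cyclic_cover; have [[x /eqP x0] _] := simpleM.
  by exists x; exact: simple_generator.
- split; first exact: simple_cover_semisimple.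
  exact: simple_cover_idempotents_lift.
Qed.
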